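(* Let $\mathcal H$ be the Hermitian polar space of a non-degenerate $\sigma$-Hermitian form of finite Witt index $n\ge2$ and anisotropic defect $d>0$ (possibly infinite) over a field $\mathbb F$. Let $\{\{p_1,\dots,p_n\},\{p'_1,\dots,p'_n\}\}$ be a frame of $\mathcal H$ and let $F_n$ be the set of the $2^n$ maximal singular subspaces $\langle x_1,\dots,x_n\rangle$ with $x_i\in\{p_i,p'_i\}$ for each $i$. Then $F_n$ generates the dual polar space $\mathcal H_n$.
   Context: Setting: $h$ non-degenerate $\sigma$-Hermitian ($\sigma\ne\mathrm{id}$ involutory) on $V=V_1\oplus\cdots\oplus V_n\oplus V_0$ with $V_i$ pairwise orthogonal hyperbolic planes and $V_0$ anisotropic orthogonal to them, $d=\dim V_0$. Points of $\mathcal H$: totally isotropic 1-spaces; $x\perp y$ means $h(x,y)=0$. $S_k(\mathcal H)$: totally isotropic subspaces of dimension $k$. A frame is a pair of bases $\{p_1,\dots,p_n\}$, $\{p'_1,\dots,p'_n\}$ of two disjoint maximal totally isotropic subspaces such that $p_i\perp p'_j$ iff $i\ne j$. The dual polar space $\mathcal H_n$ has points $S_n(\mathcal H)$ and lines $\{Z\in S_n(\mathcal H): Z\supset X\}$ for $X\in S_{n-1}(\mathcal H)$. A set generates a point-line geometry if the smallest subspace (set closed under taking lines meeting it in $\ge2$ points) containing it is the whole point set. *)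

(* Defs.v *)
From HB Require Import structures.
From mathcomp Require Import all_boot all_order all_algebra.
Set Implicit Arguments. Unset Strict Implicit. Unset Printing Implicit Defensive.
Import GRing.Theory.
Local Open Scope ring_scope.

Section HermitianPolar.
Variables (F : fieldType) (V : lmodType F).

Definition hp_sigma_hermitian (sigma : {rmorphism F -> F}) (h : V -> V -> F) : Prop :=
  (forall a x y z, h (a *: x + y) z = a * h x z + h y z) /\
  (forall x y, h y x = sigma (h x y)).

Definition hp_nondegenerate (h : V -> V -> F) : Prop :=
  forall x, (forall y, h x y = 0) -> x = 0.

(* Hyperbolic pairs e_i, f_i : V_i = <e_i, f_i> pairwise orthogonal hyperbolic
   planes; V_0 = their orthogonal complement is anisotropic and nonzero (d > 0). *)
Definition hp_witt_index_defect_pos (h : V -> V -> F) (n : nat) : Prop :=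
  exists (e f : 'I_n -> V),
    [/\ forall i j, h (e i) (e j) = 0,
        forall i j, h (f i) (f j) = 0,
        forall i j, h (e i) (f j) = (i == j)%:R,
        (forall x, (forall i, h x (e i) = 0 /\ h x (f i) = 0) ->
                   h x x = 0 -> x = 0) &
        exists x, x <> 0 /\ forall i, h x (e i) = 0 /\ h x (f i) = 0].

Definition hp_span k (s : 'I_k -> V) : V -> Prop :=
  fun v => exists c : 'I_k -> F, v = \sum_(i < k) c i *: s i.

Definition hp_free k (s : 'I_k -> V) : Prop :=
  forall c : 'I_k -> F, \sum_(i < k) c i *: s i = 0 -> forall i, c i = 0.

Definition hp_is_subspace (S : V -> Prop) : Prop :=
  S 0 /\ forall a x y, S x -> S y -> S (a *: x + y).

Definition hp_has_dim (k : nat) (S : V -> Prop) : Prop :=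
  exists s : 'I_k -> V, hp_free s /\ forall v, S v <-> hp_span s v.

Definition hp_tot_isotropic (h : V -> V -> F) (S : V -> Prop) : Prop :=
  hp_is_subspace S /\ forall x y, S x -> S y -> h x y = 0.

Definition hp_max_tot_isotropic (h : V -> V -> F) (S : V -> Prop) : Prop :=
  hp_tot_isotropic h S /\
  forall T, hp_tot_isotropic h T -> (forall x, S x -> T x) -> forall x, T x -> S x.

Definition hp_Sk (h : V -> V -> F) (k : nat) (S : V -> Prop) : Prop :=
  hp_tot_isotropic h S /\ hp_has_dim k S.

(* A hp_frame, with the points p_i, p'_i given by representative vectors u i, u' i. *)
Definition hp_frame (h : V -> V -> F) n (u u' : 'I_n -> V) : Prop :=
  [/\ hp_free u /\ hp_free u',
      hp_max_tot_isotropic h (hp_span u), hp_max_tot_isotropic h (hp_span u'),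
      (forall x, hp_span u x -> hp_span u' x -> x = 0) &
      forall i j, h (u i) (u' j) = 0 <-> i != j].

(* Dual polar space H_n: points S_n(H); line of X in S_{n-1}(H). *)
Definition hp_dpline (h : V -> V -> F) n (X : V -> Prop) : (V -> Prop) -> Prop :=
  fun Z => hp_Sk h n Z /\ forall x, X x -> Z x.

Definition hp_dp_subspace (h : V -> V -> F) n (Y : (V -> Prop) -> Prop) : Prop :=
  (forall Z, Y Z -> hp_Sk h n Z) /\
  forall X, hp_Sk h n.-1 X ->
    (exists Z1 Z2, [/\ Z1 <> Z2, hp_dpline h n X Z1, hp_dpline h n X Z2, Y Z1 & Y Z2]) ->
    forall Z, hp_dpline h n X Z -> Y Z.

Definition hp_dp_generates (h : V -> V -> F) n (A : (V -> Prop) -> Prop) : Prop :=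
  forall Y, hp_dp_subspace h n Y -> (forall Z, A Z -> Y Z) ->
    forall Z, hp_Sk h n Z -> Y Z.

Definition hp_frame_subspaces n (u u' : 'I_n -> V) : (V -> Prop) -> Prop :=
  fun Z => exists b : 'I_n -> bool, Z = hp_span (fun i => if b i then u i else u' i).

End HermitianPolar.

(* Main.v *)
Require Import Defs.
From HB Require Import structures.
From mathcomp Require Import all_boot all_order all_algebra.
From mathcomp Require Import boolp ring.
Set Implicit Arguments. Unset Strict Implicit. Unset Printing Implicit Defensive.
Import GRing.Theory.
Local Open Scope ring_scope.

(** Let Y be a subspace of the dual polar space and (p, p') a hyperbolic pair
    such that every maximal subspace through p or p' lies in Y; the point is that
    then every maximal Z lies in Y.  Only subspaces containing the part of Z
    orthogonal to p and p' are needed, so the vectors of the other frame pairs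
    lying in Z are kept, and the theorem follows by treating the pairs in turn.
    If X is singular of dimension n-1 and orthogonal to p and p', then the line of
    X meets Y in <X, p> and <X, p'>, so it is contained in Y.  Otherwise write
    Z = R + <y, y'> with R orthogonal to p and p', y = p + w and y' = p' + w'.
    Since the defect is positive there is a non-isotropic v orthogonal to Z, p, p'.
    As sigma is not the identity, the trace is onto the fixed field, so some
    t has trace -h(v, v); then q = ty + y' is orthogonal to isotropic vectors
    x_a = a v + (w' - sigma(t) w) with a sigma(a) = 1, all orthogonal to p and p'.
    The lines of R + <x_a> put R + <x_a, q> in Y, and two values of a
    make the line of R + <q>, which contains Z, lie in Y. *)

(** * Linear algebra in a space of arbitrary dimension: adjoining vectors, kernels, dimension
    counts *)

Section LinearAlgebra.
Variables (F : fieldType) (V : lmodType F).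
Implicit Types (S T : V -> Prop) (g : V -> F).

Definition adjoin S (v : V) : V -> Prop := fun x => exists a y, S y /\ x = a *: v + y.

Lemma subspaceD S x y : hp_is_subspace S -> S x -> S y -> S (x + y).
Proof. by move=> [_ SD] Sx Sy; rewrite -[x]scale1r; apply: SD. Qed.

Lemma subspaceZ S a x : hp_is_subspace S -> S x -> S (a *: x).
Proof. by move=> [S0 SD] Sx; rewrite -[_ *: _]addr0; apply: SD. Qed.

Lemma subspaceB S x y : hp_is_subspace S -> S x -> S y -> S (x - y).
Proof. by move=> SS Sx Sy; rewrite -scaleN1r; apply: subspaceD => //; apply: subspaceZ. Qed.

Lemma subspace_sum S k (c : 'I_k -> F) (s : 'I_k -> V) :
  hp_is_subspace S -> (forall i, S (s i)) -> S (\sum_(i < k) c i *: s i).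
Proof.
move=> SS Ss; apply: big_ind => [|x y|i _]; first by case: SS.
- exact: subspaceD.
- exact: subspaceZ.
Qed.

Lemma span_subspace k (s : 'I_k -> V) : hp_is_subspace (hp_span s).
Proof.
split; first by exists (fun=> 0); rewrite big1 // => i _; rewrite scale0r.
move=> a x y [c ->] [d ->]; exists (fun i => a * c i + d i).
rewrite scaler_sumr -big_split; apply: eq_bigr => i _ /=.
by rewrite scalerDl scalerA.
Qed.

Lemma mem_span k (s : 'I_k -> V) i : hp_span s (s i).
Proof.
exists (fun j => (j == i)%:R); rewrite (bigD1 i) //= eqxx scale1r big1 ?addr0 // => j /negPf ->.
by rewrite scale0r.
Qed.

Lemma adjoin_subspace S v : hp_is_subspace S -> hp_is_subspace (adjoin S v).
Proof.
move=> SS; split; first by exists 0, 0; rewrite scale0r addr0; case: SS.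
move=> a _ _ [b [x [Sx ->]]] [c [y [Sy ->]]]; exists (a * b + c), (a *: x + y).
split; first by case: SS => _; apply.
by rewrite scalerDr scalerA scalerDl addrACA.
Qed.

Lemma mem_adjoin S v : hp_is_subspace S -> adjoin S v v.
Proof. by case=> S0 _; exists 1, 0; rewrite scale1r addr0. Qed.

Lemma sub_adjoin S v x : S x -> adjoin S v x.
Proof. by move=> Sx; exists 0, x; rewrite scale0r add0r. Qed.

Lemma adjoin_min S T v : hp_is_subspace T -> (forall x, S x -> T x) -> T v ->
  forall x, adjoin S v x -> T x.
Proof. by move=> [_ TD] sST Tv x [a [y [/sST Ty ->]]]; apply: TD. Qed.

Lemma has_dim_adjoin S k v : hp_is_subspace S -> hp_has_dim k S -> ~ S v ->
  hp_has_dim k.+1 (adjoin S v).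
Proof.
move=> SS [s [fs Ss]] Sv.
pose s' (i : 'I_k.+1) := if unlift ord0 i is Some j then s j else v.
have sumE c : \sum_(i < k.+1) c i *: s' i =
    c ord0 *: v + \sum_(i < k) c (lift ord0 i) *: s i.
  by rewrite big_ord_recl /s' unlift_none; under eq_bigr do rewrite liftK.
exists s'; split=> [c|x].
  rewrite sumE => c0.
  have c00 : c ord0 = 0.
    apply: contra_notP Sv => /eqP cn0; apply/Ss.
    exists (fun i => - (c ord0)^-1 * c (lift ord0 i)).
    apply: (scalerI cn0); move/eqP: c0; rewrite addr_eq0 => /eqP ->.
    rewrite scaler_sumr -sumrN; apply: eq_bigr => i _.
    by rewrite scalerA mulrA mulrN divff // mulN1r scaleNr.
  move: c0; rewrite c00 scale0r add0r => /fs cl i.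
  by case: (unliftP ord0 i) => [j|] ->.
split=> [[a [y [/Ss [c ->] ->]]]|[c ->]].
  exists (fun i => if unlift ord0 i is Some j then c j else a).
  by rewrite sumE unlift_none; under [in RHS]eq_bigr do rewrite liftK.
rewrite sumE; exists (c ord0), (\sum_(i < k) c (lift ord0 i) *: s i); split=> //.
by apply/Ss; exists (fun i => c (lift ord0 i)).
Qed.

Lemma scalar_sum g k (c : 'I_k -> F) (s : 'I_k -> V) : scalar g ->
  g (\sum_(i < k) c i *: s i) = \sum_(i < k) c i * g (s i).
Proof.
move=> gL.
have g0 : g 0 = 0 by have := gL (-1) 0 0; rewrite scaler0 addr0 mulN1r addNr.
have gD x y : g (x + y) = g x + g y by have := gL 1 x y; rewrite scale1r mul1r.
have gZ a x : g (a *: x) = a * g x by have := gL a x 0; rewrite !addr0 g0 addr0.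
by rewrite (big_morph _ gD g0); apply: eq_bigr.
Qed.

(** Some basis vector [s i0] has a nonzero value under [g]; subtracting multiples of it moves the
    other basis vectors into the kernel, where they form a basis. *)
Lemma has_dim_ker T k g y : hp_is_subspace T -> scalar g ->
  hp_has_dim k.+1 T -> T y -> g y <> 0 -> hp_has_dim k (fun x => T x /\ g x = 0).
Proof.
move=> TS gL [s [fs Ts]] /Ts [d ->] gy.
have [i0 gi0] : exists i, g (s i) != 0.
  apply: contrapT => ng; apply: gy; rewrite scalar_sum // big1 // => i _.
  have [->|gi] := eqVneq (g (s i)) 0; first by rewrite mulr0.
  by case: ng; exists i.
pose mu j := g (s (lift i0 j)) / g (s i0).
pose s' j := s (lift i0 j) - mu j *: s i0.
have sumE c : \sum_(j < k) c j *: s' j =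
    (- \sum_(j < k) c j * mu j) *: s i0 + \sum_(j < k) c j *: s (lift i0 j).
  rewrite scaleNr scaler_suml -sumrN -big_split; apply: eq_bigr => j _ /=.
  by rewrite scalerBr scalerA addrC.
exists s'; split=> [c|x].
  pose e i := if unlift i0 i is Some j then c j else - \sum_(j < k) c j * mu j.
  have -> : \sum_(j < k) c j *: s' j = \sum_(i < k.+1) e i *: s i.
    by rewrite sumE (bigD1_ord i0) //= /e unlift_none; under [in RHS]eq_bigr do rewrite liftK.
  by move=> /fs e0 j; have := e0 (lift i0 j); rewrite /e liftK.
split=> [[/Ts [c ->]]|[c ->]].
  rewrite scalar_sum // (bigD1_ord i0) //= => gc.
  exists (fun j => c (lift i0 j)); rewrite sumE (bigD1_ord i0) //=; congr (_ *: _ + _).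
  apply: (mulIf gi0); rewrite mulNr mulr_suml.
  move/eqP: gc; rewrite addr_eq0 => /eqP ->; congr (- _); apply: eq_bigr => j _.
  by rewrite mulrA mulfVK.
split; first apply: subspace_sum => // j.
  by apply: subspaceB; rewrite // ?subspaceZ //; try apply: subspaceZ => //; apply/Ts; apply: mem_span.
rewrite scalar_sum // big1 // => j _.
have -> : s' j = (- mu j) *: s i0 + s (lift i0 j) by rewrite /s' scaleNr addrC.
by rewrite gL mulNr mulfVK // addNr mulr0.
Qed.

(** Change of generators becomes a matrix product, so that rank arguments apply even if [V] is
    infinite-dimensional. *)
Lemma mulmx_sum m k l (A : 'M[F]_(m, k)) (B : 'M_(k, l)) (s : 'I_l -> V) i :
  \sum_(j < k) A i j *: (\sum_(p < l) B j p *: s p) = \sum_(p < l) (A *m B) i p *: s p.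
Proof.
under eq_bigr do rewrite scaler_sumr.
rewrite exchange_big; apply: eq_bigr => p _ /=.
by rewrite mxE scaler_suml; apply: eq_bigr => j _; rewrite scalerA.
Qed.

Lemma row_free_eq0 m k (A : 'M[F]_(m, k)) :
  (forall c : 'rV_m, c *m A = 0 -> c = 0) -> row_free A.
Proof.
move=> A0; rewrite -kermx_eq0; apply/eqP/row_matrixP => i.
by rewrite row0; apply: A0; rewrite -row_mul mulmx_ker row0.
Qed.

(** The coordinate matrix of an independent family has independent rows, and its rank is at most its
    number of columns. *)
Lemma free_span_le m k (a : 'I_m -> V) (s : 'I_k -> V) :
  hp_free a -> (forall i, hp_span s (a i)) -> (m <= k)%N.
Proof.
move=> fa sa; have [C aE] := boolp.choice sa.
suff : row_free (\matrix_(i, j) C i j) by move=> /eqP <-; rewrite rank_leq_col.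
apply: row_free_eq0 => c cC; apply/rowP => i; rewrite mxE.
apply: (fa (fun i => c 0 i)); under eq_bigr do rewrite aE.
transitivity (\sum_(p < k) (c *m \matrix_(i, j) C i j) 0 p *: s p).
  by rewrite -mulmx_sum; apply: eq_bigr => j _; congr (_ *: _); apply: eq_bigr => p _; rewrite mxE.
by rewrite cC big1 // => p _; rewrite mxE scale0r.
Qed.

(** A vector of [T] outside the span of [a] would give n + 1 independent vectors in a space spanned
    by n. *)
Lemma has_dim_eq T n (a : 'I_n -> V) : hp_is_subspace T -> hp_has_dim n T ->
  hp_free a -> (forall i, T (a i)) -> T = hp_span a.
Proof.
move=> TS [s [fs Ts]] fa Ta; apply/funext => x; apply/propext; split; last first.
  by move=> [c ->]; apply: subspace_sum.
move=> Tx; apply: contrapT => ax.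
have [b [fb bE]] : hp_has_dim n.+1 (adjoin (hp_span a) x).
  by apply: has_dim_adjoin ax; [apply: span_subspace | exists a].
suff : (n.+1 <= n)%N by rewrite ltnn.
apply: (free_span_le fb) => i; apply/Ts.
apply: (@adjoin_min (hp_span a) T x) => //; first by move=> y [c ->]; apply: subspace_sum.
by apply/bE; apply: mem_span.
Qed.

(** The left kernel of the evaluation matrix [M] has rank at least m - k, hence more than d. It
    yields that many independent common zeros, too many for all to lie in [R]. *)
Lemma exists_common_zero m k d (a : 'I_m -> V) (g : 'I_k -> V -> F) (R : V -> Prop) :
  hp_free a -> (forall j, scalar (g j)) -> hp_has_dim d R -> (d + k < m)%N ->
  exists x, (forall j, g j x = 0) /\ ~ R x.
Proof.
move=> fa gL [r [fr Rr]] dkm; apply: contrapT => nx.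
pose M := \matrix_(i < m, j < k) g j (a i).
pose B := row_base (kermx M).
pose b i := \sum_(j < m) B i j *: a j.
have BM : B *m M = 0.
  by apply/eqP; rewrite -sub_kermx eq_row_base.
suff : (\rank (kermx M) <= d)%N.
  rewrite mxrank_ker leq_subLR => mle.
  have := leq_trans dkm (leq_trans mle (leq_add (rank_leq_col M) (leqnn d))).
  by rewrite addnC ltnn.
apply: (@free_span_le _ _ b r) => [c bc i|i].
  pose cm : 'rV_(\rank (kermx M)) := \row_j c j.
  have cB : cm *m B = 0.
    apply/rowP => j; rewrite [RHS]mxE.
    apply: (fa (fun j => (cm *m B) 0 j)); rewrite -mulmx_sum -[RHS]bc.
    by apply: eq_bigr => p _; rewrite mxE.
  have /(row_free_inj (row_base_free _)) : cm *m B = 0 *m B by rewrite cB mul0mx.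
  by move=> /rowP /(_ i); rewrite !mxE.
apply/Rr; apply: contrapT => Rb; apply: nx; exists (b i); split=> // j.
have : (B *m M) i j = 0 by rewrite BM mxE.
by rewrite mxE scalar_sum // => B0; rewrite -[RHS]B0; apply: eq_bigr => p _; rewrite [M _ _]mxE.
Qed.

End LinearAlgebra.

(** * Hermitian form identities, and elements of prescribed trace or norm for [sigma] *)

Section HermitianForm.
Variables (F : fieldType) (V : lmodType F) (sigma : {rmorphism F -> F}).
Variable h : V -> V -> F.
Hypotheses (sigmaK : involutive sigma) (sigma_neq : exists x, sigma x <> x).
Hypothesis h_herm : hp_sigma_hermitian sigma h.

Lemma form_scalar z : scalar (h^~ z).
Proof. by move=> a x y; rewrite /= h_herm.1. Qed.

Lemma formC x y : h y x = sigma (h x y). Proof. exact: h_herm.2. Qed.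

Lemma form_eq0C x y : h x y = 0 -> h y x = 0.
Proof. by rewrite [h y x]formC => ->; rewrite rmorph0. Qed.

Lemma formDl x y z : h (x + y) z = h x z + h y z.
Proof. by rewrite -[x]scale1r h_herm.1 mul1r scale1r. Qed.

Lemma form0l z : h 0 z = 0.
Proof. by have /eqP := formDl 0 0 z; rewrite addr0 -subr_eq0 opprD addNKr oppr_eq0 => /eqP. Qed.

Lemma formZl a x z : h (a *: x) z = a * h x z.
Proof. by rewrite -[a *: x]addr0 h_herm.1 form0l addr0. Qed.

Lemma formNl x z : h (- x) z = - h x z.
Proof. by rewrite -scaleN1r formZl mulN1r. Qed.

Lemma formDr x y z : h z (x + y) = h z x + h z y.
Proof. by rewrite formC formDl rmorphD -!formC. Qed.

Lemma formZr a x z : h z (a *: x) = sigma a * h z x.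
Proof. by rewrite formC formZl rmorphM -formC. Qed.

Lemma formNr x z : h z (- x) = - h z x.
Proof. by rewrite formC formNl rmorphN -formC. Qed.

Definition formE := (formDl, formDr, formNl, formNr, formZl, formZr).

Lemma form_suml k (c : 'I_k -> F) (s : 'I_k -> V) z :
  h (\sum_(i < k) c i *: s i) z = \sum_(i < k) c i * h (s i) z.
Proof. exact: (scalar_sum _ _ (form_scalar z)). Qed.

Lemma span_perp k (s : 'I_k -> V) z : (forall i, h z (s i) = 0) ->
  forall x, hp_span s x -> h x z = 0.
Proof.
by move=> sz _ [c ->]; rewrite form_suml big1 // => i _; rewrite (form_eq0C (sz i)) mulr0.
Qed.

Lemma Sk_adjoin k S v : hp_Sk h k S -> (forall s, S s -> h s v = 0) -> h v v = 0 ->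
  ~ S v -> hp_Sk h k.+1 (adjoin S v).
Proof.
move=> [[SS Si] Sd] Sv vv nSv; split; last exact: has_dim_adjoin.
split=> [|_ _ [a [x [Sx ->]]] [b [y [Sy ->]]]]; first exact: adjoin_subspace.
by rewrite !formE vv (Si _ _ Sx Sy) (Sv _ Sx) (form_eq0C (Sv _ Sy)); ring.
Qed.

(** One element of nonzero trace suffices: multiplying it by c over its trace, a factor fixed by
    [sigma], gives trace c. *)
Lemma exists_trace c : sigma c = c -> exists t, t + sigma t = c.
Proof.
move=> sc; suff [a a0] : exists a, a + sigma a != 0.
  exists (c * a / (a + sigma a)).
  by rewrite !(rmorphM, fmorphV, rmorphD) sigmaK sc [sigma a + a]addrC -mulrDl -mulrDr mulfK.
have [b bb] := sigma_neq; apply: contrapT => na.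
have tr0 a : a + sigma a = 0.
  by apply/eqP/negPn/negP => a0; apply: na; exists a.
(* The vanishing trace of 1 means characteristic 2, and then the vanishing trace of [b] gives sigma
   b = b. *)
apply: bb; have := tr0 (1 : F); have := tr0 b; rewrite rmorph1 => b0 two0.
have : b + b = 0 by rewrite -[b]mulr1 -mulrDr two0 mulr0.
by rewrite -b0 => /addrI.
Qed.

(** As in Hilbert 90, b / sigma b has norm 1; it differs from 1 as soon as [sigma] moves b. *)
Lemma exists_norm1 : exists a, a * sigma a = 1 /\ a <> 1.
Proof.
have [b bb] := sigma_neq.
have b0 : b != 0 by apply: contra_notN bb => /eqP ->; rewrite rmorph0.
have sb0 : sigma b != 0 by rewrite fmorph_eq0.
exists (b / sigma b); split; first by rewrite rmorphM fmorphV sigmaK mulf_div [_ * b]mulrC divff ?mulf_neq0.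
by move=> /(congr1 ( *%R^~ (sigma b))) /=; rewrite mulfVK // mul1r => /esym.
Qed.

(** * Dimension bounds from the Witt index and the positive defect *)

Section WittIndex.
Variable n : nat.
Hypothesis witt : hp_witt_index_defect_pos h n.

(** The vectors of [T] orthogonal to all [e i] have coordinates in [K], of rank n + 1 - rank [B].
    They lie in the span of the [e i] and are orthogonal to [T], which forces rank [K] + rank [B] <=
    n. *)
Lemma tot_isotropic_dim_lt T : hp_tot_isotropic h T -> ~ hp_has_dim n.+1 T.
Proof.
case: witt => e [f [ee ff ef V0 _]] [TS Ti] [s [fs Ts]].
have fe i j : h (f i) (e j) = (i == j)%:R by rewrite formC ef rmorph_nat eq_sym.
have Tss i : T (s i) by apply/Ts; apply: mem_span.
pose A := \matrix_(i, j) h (s i) (f j); pose B := \matrix_(i, j) h (s i) (e j).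
pose comb (c : 'rV_n.+1) := \sum_(i < n.+1) c 0 i *: s i.
have combT c : T (comb c) by exact: subspace_sum.
have combf c j : h (comb c) (f j) = (c *m A) 0 j.
  by rewrite form_suml !mxE; apply: eq_bigr => i _; rewrite !mxE.
have combe c j : h (comb c) (e j) = (c *m B) 0 j.
  by rewrite form_suml !mxE; apply: eq_bigr => i _; rewrite !mxE.
(* An isotropic vector orthogonal to all e_i lies in <e_1, ..., e_n>. *)
have combE c : c *m B = 0 -> comb c = \sum_(j < n) (c *m A) 0 j *: e j.
  move=> cB; have ce j : h (comb c) (e j) = 0 by rewrite combe cB mxE.
  apply/eqP; rewrite -subr_eq0; apply/eqP.
  set x := comb c - _.
  have xe j : h x (e j) = 0.
    by rewrite formDl formNl ce form_suml big1 ?subr0 // => i _; rewrite ee mulr0.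
  have xf j : h x (f j) = 0.
    rewrite formDl formNl combf form_suml (bigD1 j) //= ef eqxx mulr1 big1 ?addr0 ?subrr // => i ij.
    by rewrite ef (negPf ij) mulr0.
  apply: V0 => //; rewrite {2}/x formDr formNr.
  rewrite [h x (\sum_(j < n) _)]formC form_suml.
  rewrite big1 => [|j _]; last by rewrite (form_eq0C (xe j)) mulr0.
  rewrite rmorph0 subr0 formDl formNl Ti // form_suml big1 ?subr0 // => j _.
  by rewrite (form_eq0C (ce j)) mulr0.
pose K := kermx B.
(* By [combE] a row of [K] killed by [A] gives the zero combination of a basis, so [A] is injective
   on [K]. *)
have KA : \rank (K *m A) = \rank K.
  apply/eqP; rewrite -(mxrank_mul_ker K A) -[X in X == _]addn0 eqn_add2l eq_sym mxrank_eq0.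
  apply/eqP/row_matrixP => i; rewrite row0.
  have := row_sub i (K :&: kermx A)%MS; rewrite sub_capmx => /andP[].
  move: (row i _) => c /sub_kermxP cB /sub_kermxP cA.
  have := combE c cB; rewrite cA big1 => [|j _]; last by rewrite mxE scale0r.
  by move=> /fs c0; apply/rowP => j; rewrite c0 mxE.
(* Each entry is the form on a vector with coordinates in [K] and some [s j], zero because [T] is
   totally isotropic. *)
have KAB : (K *m A) *m (map_mx sigma B)^T = 0.
  apply/row_matrixP => i; rewrite row0 2!row_mul; apply/rowP => j; rewrite [RHS]mxE.
  have cB : row i K *m B = 0 by rewrite -row_mul mulmx_ker row0.
  have <- : h (comb (row i K)) (s j) = 0 by apply: Ti.
  rewrite (combE _ cB) form_suml mxE; apply: eq_bigr => p _.
  by rewrite !mxE -formC.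
have := mulmx0_rank_max KAB.
rewrite KA mxrank_tr mxrank_map mxrank_ker subnK ?ltnn //.
exact: rank_leq_row.
Qed.

(** Otherwise adjoining [v] would give a totally isotropic subspace of dimension n + 1. *)
Lemma perp_maximal_mem Z v : hp_Sk h n Z -> (forall z, Z z -> h z v = 0) -> h v v = 0 -> Z v.
Proof.
move=> ZS Zv vv; apply: contrapT => nv.
have [Ti Td] := Sk_adjoin ZS Zv vv nv; exact: tot_isotropic_dim_lt Td.
Qed.

(** The positive defect enters here: a nonzero vector of V_0 is outside the span of the 2n
    hyperbolic vectors. *)
Lemma exists_free_double : exists a : 'I_(n + n).+1 -> V, hp_free a.
Proof.
case: witt => e [f [ee ff ef _ [x [x0 xef]]]].
have fe i j : h (f i) (e j) = (i == j)%:R by rewrite formC ef rmorph_nat eq_sym.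
pose t (i : 'I_(n + n)) := match split i with inl j => e j | inr j => f j end.
have sumE (c : 'I_(n + n) -> F) : \sum_i c i *: t i =
    \sum_(j < n) c (lshift n j) *: e j + \sum_(j < n) c (rshift n j) *: f j.
  rewrite big_split_ord /=; congr (_ + _); apply: eq_bigr => j _; rewrite /t.
    by rewrite (unsplitK (inl j)).
  by rewrite (unsplitK (inr j)).
have sume (c : 'I_(n + n) -> F) j : h (\sum_i c i *: t i) (e j) = c (rshift n j).
  rewrite sumE formDl !form_suml big1 ?add0r => [|i _]; last by rewrite ee mulr0.
  rewrite (bigD1 j) //= fe eqxx mulr1 big1 ?addr0 // => i /negPf ij.
  by rewrite fe ij mulr0.
have sumf (c : 'I_(n + n) -> F) j : h (\sum_i c i *: t i) (f j) = c (lshift n j).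
  rewrite sumE formDl !form_suml addrC big1 ?add0r => [|i _]; last by rewrite ff mulr0.
  rewrite (bigD1 j) //= ef eqxx mulr1 big1 ?addr0 // => i /negPf ij.
  by rewrite ef ij mulr0.
have ft : hp_free t.
  move=> c c0 i; rewrite -(splitK i); case: (split i) => j /=.
    by rewrite -sumf c0 form0l.
  by rewrite -sume c0 form0l.
have [a [fa _]] : hp_has_dim (n + n).+1 (adjoin (hp_span t) x); last by exists a.
apply: has_dim_adjoin; [exact: span_subspace | by exists t |].
move=> [c xE]; apply: x0; rewrite xE big1 // => i _.
have [xe xf] : (forall j, h x (e j) = 0) /\ (forall j, h x (f j) = 0).
  by split=> j; case: (xef j).
rewrite -(splitK i); case: (split i) => j /=.
  by rewrite -sumf -xE xf scale0r.
by rewrite -sume -xE xe scale0r.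
Qed.

(** Orthogonality to [Z], [p] and [p'] amounts to n + 2 linear conditions; on 2n + 1 independent
    vectors they leave dimension at least n - 1, which exceeds d. *)
Lemma exists_perp Z p p' d R : hp_Sk h n Z -> hp_has_dim d R -> (d + 2 <= n)%N ->
  exists v, [/\ forall z, Z z -> h z v = 0, h v p = 0, h v p' = 0 & ~ R v].
Proof.
move=> [_ [s [_ Zs]]] Rd dn; have [a fa] := exists_free_double.
pose t (i : 'I_(n + 2)) :=
  match split i with inl j => s j | inr j => if j == 0 then p else p' end.
have [||v [tv Rv]] := @exists_common_zero _ _ _ _ _ _ (fun i => h^~ (t i)) R fa _ Rd.
- by move=> i; apply: form_scalar.
- by rewrite ltnS addnCA leq_add2l.
exists v; split=> // [z /Zs zs||].
- by apply: span_perp zs => i; have := tv (lshift 2 i); rewrite /t (unsplitK (inl i)).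
- by have := tv (rshift n 0); rewrite /t (unsplitK (inr 0)).
- by have := tv (rshift n 1); rewrite /t (unsplitK (inr 1)).
Qed.

End WittIndex.

(** * Filling [Y] from a single hyperbolic pair *)

Section KeyStep.
Variables (m : nat) (p p' : V) (Y : (V -> Prop) -> Prop) (R : V -> Prop).
Hypothesis witt : hp_witt_index_defect_pos h m.+2.
Hypothesis Ysub : hp_dp_subspace h m.+2 Y.
Hypotheses (pp : h p p = 0) (p'p' : h p' p' = 0) (pp' : h p p' = 1).
Hypothesis YR : forall Z, hp_Sk h m.+2 Z -> (forall x, R x -> Z x) -> Z p \/ Z p' -> Y Z.

Lemma Y_of_perp X Z : hp_Sk h m.+1 X -> (forall x, R x -> X x) ->
  (forall x, X x -> h x p = 0 /\ h x p' = 0) ->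
  hp_Sk h m.+2 Z -> (forall x, X x -> Z x) -> Y Z.
Proof.
move=> XS RX Xpp ZS XZ; have XSS := XS.1.1.
have p'p : h p' p = 1 by rewrite formC pp' rmorph1.
have Xp : hp_Sk h m.+2 (adjoin X p).
  apply: Sk_adjoin => // [x /Xpp[]//|/Xpp[_ /eqP]].
  by rewrite pp' oner_eq0.
have Xp' : hp_Sk h m.+2 (adjoin X p').
  apply: Sk_adjoin => // [x /Xpp[]//|/Xpp[/eqP]].
  by rewrite p'p oner_eq0.
have [_ Yline] := Ysub; apply: (Yline X XS) => //; exists (adjoin X p), (adjoin X p'); split.
(* The two points of the line differ: all of <X, p'> is orthogonal to [p'], but [p] is not. *)
- move=> XX; have : adjoin X p' p by rewrite -XX; exact: mem_adjoin.
  move=> [a [x [/Xpp[_ xp'] pE]]]; have := pp'.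
  by rewrite pE formDl formZl p'p' xp' mulr0 addr0 => /esym/eqP; rewrite oner_eq0.
- by split=> // x; exact: sub_adjoin.
- by split=> // x; exact: sub_adjoin.
- by apply: YR => // [x /RX|]; [exact: sub_adjoin | left; exact: mem_adjoin].
- by apply: YR => // [x /RX|]; [exact: sub_adjoin | right; exact: mem_adjoin].
Qed.

(** The case where pairing with [p] and with [p'] gives independent functionals on [Z]; [y] and [y']
    are p + w and p' + w', and [wm] in the proof is w' - sigma(t) w. *)
Lemma Y_of_generic Z y y' : hp_Sk h m.+2 Z -> hp_has_dim m R ->
  (forall x, R x <-> (Z x /\ h x p = 0) /\ h x p' = 0) ->
  Z y -> Z y' -> h y p = 0 -> h y p' = 1 -> h y' p = 1 -> h y' p' = 0 -> Y Z.
Proof.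
move=> ZS Rd RE Zy Zy' yp yp' y'p y'p'; have [[ZSS Zi] Zd] := ZS.
have [|v [Zv vp vp' Rv]] := exists_perp witt p p' ZS Rd; first by rewrite addn2.
have RZ x : R x -> Z x by move=> /RE[[]].
have Rp x : R x -> h x p = 0 by move=> /RE[[]].
have Rp' x : R x -> h x p' = 0 by move=> /RE[].
have RS : hp_Sk h m R.
  split=> //; split=> [|x z /RZ Zx /RZ Zz]; last exact: Zi.
  split=> [|a x z /RE[[Zx xp] xp'] /RE[[Zz zp] zp']]; apply/RE.
    by rewrite !form0l; split=> //; split=> //; exact: ZSS.1.
  rewrite !formE xp xp' zp zp' mulr0 addr0; split=> //; split=> //; exact: (ZSS.2 a x z Zx Zz).
(* An isotropic [v] would lie in [Z] by maximality, hence in [R], against the choice of [v]. *)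
have c0 : h v v <> 0.
  by move=> vv; apply: Rv; apply/RE; split=> //; split=> //; exact: (perp_maximal_mem witt ZS Zv vv).
have sc : sigma (h v v) = h v v by rewrite -formC.
have [|t tr_t] := @exists_trace (- h v v); first by rewrite rmorphN sc.
have [a [Na a1]] := exists_norm1.
have py : h p y = 0 := form_eq0C yp.
have p'y' : h p' y' = 0 := form_eq0C y'p'.
have p'y : h p' y = 1 by rewrite formC yp' rmorph1.
have py' : h p y' = 1 by rewrite formC y'p rmorph1.
have p'p : h p' p = 1 by rewrite formC pp' rmorph1.
have pv : h p v = 0 := form_eq0C vp.
have p'v : h p' v = 0 := form_eq0C vp'.
have [yv y'v] : h y v = 0 /\ h y' v = 0 by split; exact: Zv.
have [vy vy'] : h v y = 0 /\ h v y' = 0 by split; exact: form_eq0C.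
have [yy [yy' [y'y y'y']]] : h y y = 0 /\ h y y' = 0 /\ h y' y = 0 /\ h y' y' = 0.
  by do !split; exact: Zi.
(* Gram table of [p], [p'], [y], [y'], [v], except for the nonzero [h v v], to which the products
   below reduce. *)
have vals := (pp, p'p', pp', p'p, py, py', p'y, p'y', yp, yp', y'p, y'p', pv, p'v, vp, vp',
  (yv, y'v, vy, vy', yy, yy', y'y, y'y')).
pose q := t *: y + y'.
pose wm := (y' - p') - sigma t *: (y - p).
pose x (b : F) := b *: v + wm.
have xp b : h (x b) p = 0 by rewrite /x /wm !formE !vals; ring.
have xp' b : h (x b) p' = 0 by rewrite /x /wm !formE !vals; ring.
have xy b : h (x b) y = -1 by rewrite /x /wm !formE !vals; ring.
have xv b : h (x b) v = b * h v v by rewrite /x /wm !formE !vals; ring.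
have xq b : h (x b) q = 0 by rewrite /x /wm /q !formE !vals; ring.
(* The form takes the value t + sigma t = - h v v on [wm], which is orthogonal to [v]; norm 1 makes
   the two contributions cancel. *)
have xx b : b * sigma b = 1 -> h (x b) (x b) = 0.
  move=> Nb; have -> : h (x b) (x b) = b * sigma b * h v v + (t + sigma t).
    by rewrite /x /wm !formE !sigmaK !vals; ring.
  by rewrite Nb tr_t; ring.
have qp : h q p = 1 by rewrite /q !formE !vals; ring.
have qy : h q y = 0 by rewrite /q !formE !vals; ring.
have qv : h q v = 0 by rewrite /q !formE !vals; ring.
have qq : h q q = 0 by rewrite /q !formE !vals; ring.
have Zq : Z q by apply: ZSS.2.
have Rx b r : R r -> h r (x b) = 0.
  move=> Rr; rewrite /x /wm !formE (Zv _ (RZ _ Rr)) Rp // Rp' //.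
  by rewrite (Zi r y) ?(Zi r y') //; [ring | exact: RZ | exact: RZ].
clearbody x q.
have Rq r : R r -> h r q = 0 by move=> /RZ Zr; exact: Zi.
have XS b : b * sigma b = 1 -> hp_Sk h m.+1 (adjoin R (x b)).
  move=> Nb; apply: Sk_adjoin => //; [exact: Rx | exact: xx | move=> Rxb].
  have := xy b; rewrite (Zi _ _ (RZ _ Rxb) Zy) => /eqP.
  by rewrite eq_sym oppr_eq0 oner_eq0.
have Xp b z : adjoin R (x b) z -> h z p = 0 /\ h z p' = 0.
  move=> [d [r [Rr ->]]]; by rewrite !formE xp xp' Rp // Rp' // mulr0 addr0.
pose L b := adjoin (adjoin R (x b)) q.
have LS b : b * sigma b = 1 -> hp_Sk h m.+2 (L b).
  move=> Nb; apply: Sk_adjoin qq _; first exact: XS.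
    by move=> _ [d [r [Rr ->]]]; rewrite !formE xq Rq // mulr0 addr0.
  by move=> /Xp[/eqP]; rewrite qp oner_eq0.
have YL b : b * sigma b = 1 -> Y (L b).
  move=> Nb; apply: (Y_of_perp (XS b Nb)) => [r|z|//|z].
  - exact: sub_adjoin.
  - exact: Xp.
  - exact: LS.
  - exact: sub_adjoin.
have XqS : hp_Sk h m.+1 (adjoin R q).
  apply: Sk_adjoin => //; by move=> /Rp /eqP; rewrite qp oner_eq0.
have XqL b : forall z, adjoin R q z -> L b z.
  by move=> _ [d [r [Rr ->]]]; exists d, r; split=> //; exact: sub_adjoin.
have N1 : (1 : F) * sigma 1 = 1 by rewrite rmorph1 mulr1.
have [_ Yline] := Ysub; apply: (Yline _ XqS) => //; last first.
  by split=> //; apply: adjoin_min.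
exists (L 1), (L a); split; try by [exact: YL | split; [exact: LS | exact: XqL]].
(* If the two points coincided, then x a = d q + e x 1 + r; pairing with [y] gives e = 1, and then
   pairing with [v] gives a = 1. *)
move=> LL; have : L 1 (x a).
  by rewrite LL; apply: sub_adjoin; apply: mem_adjoin; exact: RS.1.1.
move=> [d [_ [[e [r [Rr ->]]] xE]]].
have e1 : e = 1.
  have := xy a; rewrite xE !formE xy qy (Zi _ _ (RZ _ Rr) Zy) => e1.
  by apply: oppr_inj; rewrite -e1; ring.
apply: a1; have := xv a; rewrite xE !formE xv qv (Zv _ (RZ _ Rr)) e1 => /esym av.
apply: (mulIf (introN eqP c0)); rewrite av; ring.
Qed.

(** If [Z] is orthogonal to [p], it contains [p]. Otherwise its part [K] orthogonal to [p] has
    dimension n - 1; either [K] is also orthogonal to [p'] and spans a line to use, or [R] has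
    dimension n - 2 and [Z] is generic. *)
Lemma Y_of_hyperbolic Z : hp_Sk h m.+2 Z ->
  (forall x, R x <-> (Z x /\ h x p = 0) /\ h x p' = 0) -> Y Z.
Proof.
move=> ZS RE; have [[ZSS Zi] Zd] := ZS.
have RZ x : R x -> Z x by move=> /RE[[]].
have [[z [Zz zp]]|nz] := EM (exists z, Z z /\ h z p <> 0); last first.
  apply: YR => //; left; apply: (perp_maximal_mem witt) => // z Zz.
  by apply: contrapT => zp; apply: nz; exists z.
pose K x := Z x /\ h x p = 0.
have KS : hp_Sk h m.+1 K.
  split; last exact: (has_dim_ker ZSS (form_scalar p) Zd Zz zp).
  split=> [|x1 x2 [Zx1 _] [Zx2 _]]; last exact: Zi.
  split=> [|a x1 x2 [Zx1 x1p] [Zx2 x2p]].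
    by split; [exact: ZSS.1 | exact: form0l].
  by split; [exact: ZSS.2 | rewrite !formE x1p x2p mulr0 addr0].
have [[y0 [Ky0 y0p']]|ny] := EM (exists y, K y /\ h y p' <> 0); last first.
  have Kp' x : K x -> h x p' = 0 by move=> Kx; apply: contrapT => xp'; apply: ny; exists x.
  by apply: (Y_of_perp KS) => // [x /RE[]//|x Kx|x []//]; split; [exact: Kx.2 | exact: Kp'].
have Rd : hp_has_dim m R.
  have -> : R = fun x => K x /\ h x p' = 0 by apply/funext => x; apply/propext/RE.
  exact: (has_dim_ker KS.1.1 (form_scalar p') KS.2 Ky0 y0p').
case: Ky0 => Zy0 y0p.
(* Scaling, and then subtracting a multiple of [y] from [z1], gives a pair dual to [p'] and [p]. *)
pose y := (h y0 p')^-1 *: y0; pose z1 := (h z p)^-1 *: z.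
have yp : h y p = 0 by rewrite formZl y0p mulr0.
have yp' : h y p' = 1 by rewrite formZl mulVf //; apply/eqP.
have z1p : h z1 p = 1 by rewrite formZl mulVf //; apply/eqP.
have [Zy Zz1] : Z y /\ Z z1 by split; exact: subspaceZ.
clearbody y z1.
apply: (@Y_of_generic Z y (z1 - h z1 p' *: y)) => //.
- by apply: subspaceB => //; apply: subspaceZ.
- by rewrite !formE yp mulr0 subr0.
- by rewrite !formE yp' mulr1 subrr.
Qed.

End KeyStep.

Lemma hyperbolic_pair_generates n p p' Y Z : (2 <= n)%N ->
  hp_witt_index_defect_pos h n -> hp_dp_subspace h n Y ->
  h p p = 0 -> h p' p' = 0 -> h p p' = 1 -> hp_Sk h n Z ->
  (forall Z', hp_Sk h n Z' -> (forall x, (Z x /\ h x p = 0) /\ h x p' = 0 -> Z' x) ->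
     Z' p \/ Z' p' -> Y Z') ->
  Y Z.
Proof.
case: n => [|[|m]] // _ witt Ysub pp p'p' pp' ZS YR.
exact: (Y_of_hyperbolic witt Ysub pp p'p' pp' YR ZS).
Qed.

(** * Induction over the pairs of the frame *)

Section Frame.
Variables (n : nat) (u u' : 'I_n -> V).
Hypothesis frame : hp_frame h u u'.

Let x (b : 'I_n -> bool) i := if b i then u i else u' i.

Lemma frame_uu i j : h (u i) (u j) = 0.
Proof. by case: frame => _ [[_ ui] _] _ _ _; apply: ui; exact: mem_span. Qed.

Lemma frame_u'u' i j : h (u' i) (u' j) = 0.
Proof. by case: frame => _ _ [[_ ui] _] _ _; apply: ui; exact: mem_span. Qed.

Lemma frame_uu' i j : i != j -> h (u i) (u' j) = 0.
Proof. by case: frame => _ _ _ _ uu'; apply: (uu' i j).2. Qed.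

Lemma frame_uu'_neq0 i : h (u i) (u' i) != 0.
Proof. by case: frame => _ _ _ _ uu'; apply/eqP => /uu'; rewrite eqxx. Qed.

Lemma frame_perp b i j : i != j -> h (x b i) (u j) = 0 /\ h (x b i) (u' j) = 0.
Proof.
move=> ij; rewrite /x; case: (b i).
  by rewrite frame_uu frame_uu'.
by rewrite frame_u'u' form_eq0C // frame_uu' // eq_sym.
Qed.

(** Pairing with the frame vector opposite to [x b i] kills every term but the i-th. *)
Lemma frame_free b : hp_free (x b).
Proof.
move=> c c0 i; pose x' := if b i then u' i else u i.
have : h (\sum_(j < n) c j *: x b j) x' = 0 by rewrite c0 form0l.
rewrite form_suml (bigD1 i) //= big1 => [|j ij]; last first.
  by rewrite /x'; have [ju ju'] := frame_perp b ij; case: (b i); rewrite ?ju ?ju' mulr0.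
rewrite addr0 => /eqP; rewrite mulf_eq0 => /orP[/eqP //|].
rewrite /x' /x; case: (b i); first by rewrite (negPf (frame_uu'_neq0 i)).
by rewrite formC fmorph_eq0 (negPf (frame_uu'_neq0 i)).
Qed.

Hypothesis witt : hp_witt_index_defect_pos h n.
Hypothesis n2 : (2 <= n)%N.

Lemma frame_subspaces_generate : hp_dp_generates h n (hp_frame_subspaces u u').
Proof.
move=> Y Ysub YF.
(* Only the indices from k on are prescribed: for k = 0 a dimension count puts [Z] in F_n, and for k
   = n every maximal [Z] qualifies. *)
suff Yk k : (k <= n)%N -> forall b Z, hp_Sk h n Z ->
    (forall i : 'I_n, (k <= i)%N -> Z (x b i)) -> Y Z.
  move=> Z ZS; apply: (Yk n (leqnn n) xpredT Z ZS) => i.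
  by rewrite leqNgt ltn_ord.
elim: k => [_ b Z [[ZSS _] Zd] Zx|k IHk kn b Z ZS Zx].
  apply: YF; exists b; apply: has_dim_eq => //; first exact: frame_free.
  by move=> i; exact: Zx.
(* The form is semilinear in its second argument, so [sigma] in [c] is what makes [h p p'] equal to
   1. *)
pose i0 := Ordinal kn; pose p := u i0; pose c := sigma (h (u i0) (u' i0)).
have c0 : c != 0 by rewrite fmorph_eq0 frame_uu'_neq0.
pose p' := c^-1 *: u' i0.
have pp' : h p p' = 1 by rewrite formZr fmorphV sigmaK mulVf // frame_uu'_neq0.
have p'p' : h p' p' = 0 by rewrite formZl formZr frame_u'u' !mulr0.
pose R z := (Z z /\ h z p = 0) /\ h z p' = 0.
have YR Z' : hp_Sk h n Z' -> (forall z, R z -> Z' z) -> Z' p \/ Z' p' -> Y Z'.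
  move=> Z'S RZ' Z'p.
  have [d Z'd] : exists d : bool, Z' (if d then u i0 else u' i0).
    case: Z'p => Z'p; [by exists true | exists false].
    by rewrite -[u' i0](scalerKV c0); apply: subspaceZ => //; exact: Z'S.1.1.
  (* The choice at [i0] is reset to the vector found in [Z']; those of index above k are orthogonal
     to [p] and [p'], so they lie in [R] and hence in [Z']. *)
  apply: (IHk (ltnW kn) (fun i => if i == i0 then d else b i) Z' Z'S) => i ki.
  rewrite /x; have [->|ii0] := eqVneq i i0; first by [].
  have [xu xu'] := frame_perp b ii0.
  apply: RZ'; split; last by rewrite formZr xu' mulr0.
  split=> //; apply: Zx; rewrite ltn_neqAle ki andbT.
  by apply: contra_neq ii0 => ki'; apply: val_inj.
exact: (hyperbolic_pair_generates n2 witt Ysub (frame_uu i0 i0) p'p' pp' ZS YR).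
Qed.

End Frame.
End HermitianForm.

Theorem mainTheorem3 (F : fieldType) (V : lmodType F)
    (sigma : {rmorphism F -> F}) (h : V -> V -> F) (n : nat)
    (u u' : 'I_n -> V) :
  (forall x, sigma (sigma x) = x) ->
  (exists x, sigma x <> x) ->
  hp_sigma_hermitian sigma h ->
  hp_nondegenerate h ->
  (2 <= n)%N ->
  hp_witt_index_defect_pos h n ->
  hp_frame h u u' ->
  hp_dp_generates h n (hp_frame_subspaces u u').
Proof.
move=> sigmaK sigma_neq h_herm _ n2 witt frame.
exact: (frame_subspaces_generate sigmaK sigma_neq h_herm frame witt n2).
Qed.
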